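(* Let $\varepsilon(x_1,x_2)=\varepsilon_1(x_1)+\varepsilon_2(x_2)$, where $\varepsilon_1,\varepsilon_2:\mathbb{R}\to\mathbb{R}$ are $C^2$-smooth, strictly positive, $1$-periodic functions. Then there exists $\lambda_0>0$ such that for any $\lambda\ge\lambda_0$ the partial differential equation $$-\Delta E=\lambda\varepsilon E\quad\text{in }\mathbb{R}^2$$ has a bounded nonzero (complex-valued) solution of the form $E(x_1,x_2)=E_1(x_1)E_2(x_2)$, where $$E_1(x_1+1)=e^{i\alpha}E_1(x_1),\qquad E_2(x_2+1)=e^{i\beta}E_2(x_2)\qquad\text{for all }x_1,x_2\in\mathbb{R},$$ for some $\alpha,\beta\in\mathbb{R}$. Furthermore, $\lambda_0$ depends only on the number $$C:=\max_{i=1,2,\ x\in\mathbb{R}}\{|\varepsilon_i(x)|,\ |\varepsilon_i'(x)|,\ |\varepsilon_i''(x)|,\ |(\varepsilon_i(x))^{-1}|\};$$ that is, $\lambda_0$ can be chosen as a function of $C$ alone, the same for all pairs $\varepsilon_1,\varepsilon_2$ with this value of $C$. *)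

(* Defs.v *)
From Stdlib Require Import Reals.
From Coquelicot Require Import Coquelicot.

Open Scope R_scope.

(* [ex_derive_n f 2 x] only says that [Derive f] is differentiable at [x], so
   differentiability of [f] itself has to be required separately. *)
Definition C2_smooth (f : R -> R) : Prop :=
  (forall (k : nat) (x : R), (k <= 2)%nat -> ex_derive_n f k x) /\
  (forall x : R, continuous (Derive_n f 2) x).

Definition one_periodic (f : R -> R) : Prop :=
  forall x : R, f (x + 1) = f x.

Definition is_maximum (A : R -> Prop) (m : R) : Prop :=
  A m /\ forall v : R, A v -> v <= m.

Definition coefficient_values (eps1 eps2 : R -> R) (v : R) : Prop :=
  exists (f : R -> R) (x : R), (f = eps1 \/ f = eps2) /\
    (v = Rabs (f x) \/ v = Rabs (Derive_n f 1 x) \/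
     v = Rabs (Derive_n f 2 x) \/ v = Rabs (/ f x)).

(* Derivative of a complex-valued function of a real variable, computed
   componentwise because Coquelicot's [Derive] is only for real-valued functions;
   like [Derive] it is total, hence meaningful only where [f] is differentiable. *)
Definition Derive_RC (f : R -> C) (x : R) : C :=
  (Derive (fun t => Re (f t)) x, Derive (fun t => Im (f t)) x).

Definition ex_derive_RC (f : R -> C) (x : R) : Prop :=
  @ex_derive R_AbsRing C_R_NormedModule f x.

Definition partial1 (E : R * R -> C) : R * R -> C :=
  fun p => Derive_RC (fun t => E (t, snd p)) (fst p).

Definition partial2 (E : R * R -> C) : R * R -> C :=
  fun p => Derive_RC (fun t => E (fst p, t)) (snd p).

(* For k > 0 continuity of E itself is not listed: it follows from the
   continuity of the first-order partial derivatives. *)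
Fixpoint Ck_plane (k : nat) (E : R * R -> C) : Prop :=
  match k with
  | O => forall p : R * R,
      @continuous (prod_UniformSpace R_UniformSpace R_UniformSpace)
        C_UniformSpace E p
  | S k' =>
      (forall p : R * R, ex_derive_RC (fun t => E (t, snd p)) (fst p)) /\
      (forall p : R * R, ex_derive_RC (fun t => E (fst p, t)) (snd p)) /\
      Ck_plane k' (partial1 E) /\ Ck_plane k' (partial2 E)
  end.

Definition laplacian (E : R * R -> C) (p : R * R) : C :=
  (partial1 (partial1 E) p + partial2 (partial2 E) p)%C.

(* Solutions are understood in the classical sense. *)
Definition is_solution (lambda : R) (eps : R * R -> R) (E : R * R -> C) : Prop :=
  Ck_plane 2 E /\
  forall p : R * R, (- laplacian E p)%C = (RtoC lambda * RtoC (eps p) * E p)%C.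

Definition bounded_plane (E : R * R -> C) : Prop :=
  exists M : R, forall p : R * R, Cmod (E p) <= M.

Definition Cexp (z : C) : C :=
  (exp (Re z) * cos (Im z), exp (Re z) * sin (Im z)).

Definition quasi_periodic (theta : R) (f : R -> C) : Prop :=
  forall x : R, f (x + 1) = (Cexp (Ci * RtoC theta) * f x)%C.

(* Main.v *)
Require Import Defs.
From Stdlib Require Import Reals ZArith Lra Lia Classical_Prop FunctionalExtensionality.
From Coquelicot Require Import Coquelicot.

Open Scope R_scope.

(** Separating variables with a constant [mu] leaves the two Hill equations
    [y'' + q y = 0] with [q = lambda eps1 - mu] and [q = lambda eps2 + mu].

    One such equation, with [q] of size [lambda]: put [w = sqrt q] and
    [Phi = int_0^1 w].  In the WKB basis [w^(-1/2) exp (+- i int w)] the ratio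
    [r] of the two components of a solution satisfies
    [r' = - 2 i w r - (i g / 2) (1 + r)^2] with [g = O (lambda^(-1/2))].  If
    [sin Phi] stays away from [0], the linear part is invertible on 1-periodic
    functions, and a contraction argument gives a small periodic [r].  The
    logarithmic derivative [u + i v] it defines is periodic with [v > 0], and
    [v' = - 2 u v], so [v^(-1/2) exp (i int v)] is a bounded quasi-periodic
    solution.

    Choice of [mu]: moving [mu] by a suitable multiple of [sqrt lambda] changes
    both phases [Phi] by an amount between a positive constant and 1, so among
    three equally spaced values of [mu] each of the two equations has at most one
    with small [sin Phi], and some value is good for both. *)

(** * A contraction principle and integrals of periodic functions *)

(** Banach's principle with all distances written as uniform pointwise bounds, so that no metric on
    the function set has to be built. The iterates from [f0] converge geometrically at each point,
    and closure of [K] under uniform limits puts the limit in [K]. *)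
Lemma contraction_fixed_point (X : Type) (K : (X -> R) -> Prop)
    (T : (X -> R) -> X -> R) (f0 : X -> R) (D : R) :
  K f0 -> 0 <= D ->
  (forall x, Rabs (T f0 x - f0 x) <= D) ->
  (forall f, K f -> K (T f)) ->
  (forall f g e, K f -> K g -> (forall x, Rabs (f x - g x) <= e) ->
     forall x, Rabs (T f x - T g x) <= e / 2) ->
  (forall f, (forall e, 0 < e ->
     exists g, K g /\ forall x, Rabs (f x - g x) <= e) -> K f) ->
  exists f, K f /\ forall x, T f x = f x.
Proof.
intros K0 D0 HD KT HT Kcl.
set (u := fix u n := match n with O => f0 | S n => T (u n) end).
assert (Ku : forall n, K (u n)) by (induction n; simpl; auto).
assert (step : forall n x, Rabs (u (S n) x - u n x) <= D * (/ 2) ^ n).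
{ induction n as [|n IH]; intros x.
  - rewrite Rmult_1_r; apply HD.
  - replace (D * (/ 2) ^ S n) with (D * (/ 2) ^ n / 2) by (simpl; field).
    apply (HT (u (S n)) (u n)); auto. }
(* The factor [1 - (/ 2) ^ k] is the exact partial geometric sum; with it the induction on [k]
   closes. *)
assert (tele : forall k n x,
  Rabs (u (n + k)%nat x - u n x) <= 2 * D * (/ 2) ^ n * (1 - (/ 2) ^ k)).
{ induction k as [|k IH]; intros n x.
  - rewrite Nat.add_0_r, Rminus_diag, Rabs_R0; simpl; lra.
  - rewrite Nat.add_succ_r.
    replace (u (S (n + k)) x - u n x)
      with ((u (S (n + k)) x - u (n + k)%nat x) + (u (n + k)%nat x - u n x))
      by ring.
    eapply Rle_trans; [apply Rabs_triang|].
    pose proof (step (n + k)%nat x) as H1; pose proof (IH n x) as H2.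
    rewrite pow_add in H1; simpl ((/ 2) ^ S k); lra. }
(* The denominator [2 * D + 1] stays positive when [D = 0]. *)
assert (small : forall e, 0 < e -> exists n, 2 * D * (/ 2) ^ n <= e).
{ intros e He.
  destruct (pow_lt_1_zero (/ 2)) with (y := e / (2 * D + 1)) as [N HN].
  - rewrite Rabs_pos_eq; lra.
  - apply Rdiv_lt_0_compat; lra.
  - exists N. specialize (HN N (le_n N)).
    assert (0 < (/ 2) ^ N) by (apply pow_lt; lra).
    rewrite Rabs_pos_eq in HN by lra.
    set (p := (/ 2) ^ N) in *; clearbody p.
    apply Rmult_lt_compat_l with (r := 2 * D + 1) in HN; [|lra].
    replace ((2 * D + 1) * (e / (2 * D + 1))) with e in HN by (field; lra).
    nra. }
assert (pos : forall n, 0 < (/ 2) ^ n) by (intro; apply pow_lt; lra).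
assert (bound : forall n m x, (n <= m)%nat ->
  Rabs (u m x - u n x) <= 2 * D * (/ 2) ^ n).
{ intros n m x Hnm.
  replace m with (n + (m - n))%nat by lia.
  eapply Rle_trans; [apply tele|].
  pose proof (Rmult_le_pos _ _ (Rmult_le_pos _ _ D0 (Rlt_le _ _ (pos n)))
    (Rlt_le _ _ (pos (m - n)%nat))); lra. }
assert (lim : forall x, ex_finite_lim_seq (fun n => u n x)).
{ intros x; apply ex_lim_seq_cauchy_corr; intros e.
  destruct (small (e / 4)) as [N HN]; [pose proof (cond_pos e); lra|].
  exists N; intros n m Hn Hm.
  replace (u n x - u m x) with ((u n x - u N x) - (u m x - u N x)) by ring.
  eapply Rle_lt_trans; [apply Rabs_triang|]; rewrite Rabs_Ropp.
  pose proof (bound N n x Hn); pose proof (bound N m x Hm).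
  pose proof (cond_pos e); lra. }
set (f := fun x => real (Lim_seq (fun n => u n x))).
assert (approx : forall n x, Rabs (f x - u n x) <= 2 * D * (/ 2) ^ n).
{ intros n x.
  pose proof (Lim_seq_correct' _ (lim x)) as Hl; fold (f x) in Hl.
  apply (is_lim_seq_le_loc (fun m => Rabs (u m x - u n x))
    (fun _ => 2 * D * (/ 2) ^ n) (Rabs (f x - u n x)) (2 * D * (/ 2) ^ n)).
  - exists n; intros m Hm; apply bound; auto.
  - apply (is_lim_seq_abs _ (f x - u n x)).
    apply is_lim_seq_minus'; auto; apply is_lim_seq_const.
  - apply is_lim_seq_const. }
assert (Kf : K f).
{ apply Kcl; intros e He; destruct (small e He) as [n Hn].
  exists (u n); split; auto; intros x; eapply Rle_trans; eauto. }
exists f; split; auto; intros x.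
apply Rminus_diag_uniq.
(* Both [T f] and [f] are within half of [2 * D * (/ 2) ^ n] of [u (S n)], so a positive gap would
   be at most a third of itself for large [n]. *)
destruct (Req_dec (T f x - f x) 0) as [|Hne]; auto; exfalso.
apply Rabs_pos_lt in Hne.
destruct (small (Rabs (T f x - f x) / 3)) as [n Hn]; [lra|].
assert (H1 : Rabs (T f x - T (u n) x) <= 2 * D * (/ 2) ^ n / 2)
  by (apply HT; auto).
pose proof (approx (S n) x) as H2; simpl in H2.
assert (H3 : Rabs (T f x - f x)
  <= Rabs (T f x - T (u n) x) + Rabs (f x - T (u n) x)).
{ replace (T f x - f x) with ((T f x - T (u n) x) - (f x - T (u n) x)) by ring.
  eapply Rle_trans; [apply Rabs_triang|]; rewrite Rabs_Ropp; lra. }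
pose proof (Rmult_le_pos _ _ D0 (Rlt_le _ _ (pos n))); lra.
Qed.

Lemma continuous_uniform_limit (f : R -> R) (x : R) :
  (forall e, 0 < e -> exists g : R -> R,
     continuous g x /\ forall y, Rabs (f y - g y) <= e) ->
  continuous f x.
Proof.
intros H; apply filterlim_locally; intros e.
destruct (H (e / 4)) as [g [Hg Hfg]]; [pose proof (cond_pos e); lra|].
assert (He : 0 < e / 4) by (pose proof (cond_pos e); lra).
pose proof (proj1 (filterlim_locally g (g x)) Hg (mkposreal _ He)) as Hloc.
eapply filter_imp; [|exact Hloc]; intros y Hy.
change (Rabs (g y - g x) < e / 4) in Hy.
change (Rabs (f y - f x) < e).
pose proof (Hfg y) as H1; pose proof (Hfg x) as H2.
pose proof (cond_pos e).
revert H1 H2 Hy; unfold Rabs; repeat destruct Rcase_abs; lra.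
Qed.

Lemma is_derive_primitive (f : R -> R) (x : R) :
  (forall y, continuous f y) -> is_derive (fun t => RInt f 0 t) x (f x).
Proof.
intros H; apply (is_derive_RInt f (fun t => RInt f 0 t) 0); auto.
apply filter_forall; intros y; apply (@RInt_correct R_CompleteNormedModule).
apply (@ex_RInt_continuous R_CompleteNormedModule); auto.
Qed.

Lemma continuous_ex_RInt (f : R -> R) (a b : R) :
  (forall y, continuous f y) -> ex_RInt f a b.
Proof. intros H; apply (@ex_RInt_continuous R_CompleteNormedModule); auto. Qed.

Lemma RInt_window (f : R -> R) (t : R) :
  (forall y, continuous f y) ->
  RInt f t (t + 1) = RInt f 0 (t + 1) - RInt f 0 t.
Proof.
intros H.
assert (Hc : RInt f 0 t + RInt f t (t + 1) = RInt f 0 (t + 1))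
  by (apply (@RInt_Chasles R_CompleteNormedModule); apply continuous_ex_RInt; auto).
lra.
Qed.

Lemma is_derive_window (f : R -> R) (t : R) :
  (forall y, continuous f y) ->
  is_derive (fun s => RInt f s (s + 1)) t (f (t + 1) - f t).
Proof.
intros H.
apply (is_derive_ext (fun s => RInt f 0 (s + 1) - RInt f 0 s)).
{ intros s; symmetry; apply RInt_window; auto. }
apply (is_derive_minus (V := R_NormedModule)
  (fun s => RInt f 0 (s + 1)) (fun s => RInt f 0 s)).
- replace (f (t + 1)) with (scal 1 (f (t + 1)))
    by (unfold scal; simpl; unfold mult; simpl; ring).
  apply (is_derive_comp (V := R_NormedModule) (fun s => RInt f 0 s) (fun s => s + 1)).
  + apply is_derive_primitive; auto.
  + auto_derive; auto; ring.
- apply is_derive_primitive; auto.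
Qed.

Lemma derive_zero_constant (f : R -> R) (x y : R) :
  (forall t, is_derive f t 0) -> f x = f y.
Proof.
intros H.
destruct (Rtotal_order x y) as [Hlt | [-> | Hlt]]; auto.
- apply (eq_is_derive (V := R_NormedModule)); auto.
- symmetry; apply (eq_is_derive (V := R_NormedModule)); auto.
Qed.

(** The integral over [[t, t + 1]] has derivative [f (t + 1) - f t = 0], hence equals its value at
    [t = 0]. *)
Lemma RInt_add_period (f : R -> R) (t : R) :
  (forall y, continuous f y) -> one_periodic f ->
  RInt f 0 (t + 1) = RInt f 0 t + RInt f 0 1.
Proof.
intros Hc Hp.
assert (H : RInt f t (t + 1) = RInt f 0 (0 + 1)).
{ apply (derive_zero_constant (fun s => RInt f s (s + 1))); intros s.
  replace 0 with (f (s + 1) - f s) by (rewrite Hp; ring).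
  apply is_derive_window; auto. }
rewrite RInt_window, Rplus_0_l in H by auto; lra.
Qed.

Lemma RInt_window_bound (f : R -> R) (t M : R) :
  (forall y, continuous f y) -> (forall y, Rabs (f y) <= M) ->
  Rabs (RInt f t (t + 1)) <= M.
Proof.
intros Hc HM.
replace M with ((t + 1 - t) * M) by ring.
apply abs_RInt_le_const; auto; [lra | apply continuous_ex_RInt; auto].
Qed.

Lemma RInt_window_dist (f g : R -> R) (t M : R) :
  (forall y, continuous f y) -> (forall y, continuous g y) ->
  (forall y, Rabs (f y - g y) <= M) ->
  Rabs (RInt f t (t + 1) - RInt g t (t + 1)) <= M.
Proof.
intros Hf Hg HM.
change (RInt f t (t + 1) - RInt g t (t + 1))
  with (minus (RInt f t (t + 1)) (RInt g t (t + 1))).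
rewrite <- RInt_minus by (apply continuous_ex_RInt; auto).
apply RInt_window_bound; auto.
intros y; apply (continuous_minus (V := R_NormedModule)); auto.
Qed.

(** Serves for integrands that a unit shift multiplies by a constant phase: in real form their
    components are mixed by a rotation, and the window integrals inherit the same rule. *)
Lemma RInt_linear_window (f g h : R -> R) (c d t : R) :
  (forall y, continuous f y) -> (forall y, continuous g y) ->
  (forall y, h (y + 1) = c * f y + d * g y) ->
  (forall y, continuous h y) ->
  RInt h (t + 1) (t + 1 + 1) = c * RInt f t (t + 1) + d * RInt g t (t + 1).
Proof.
intros Hf Hg Hh Hc.
assert (E1 : RInt (fun y => scal 1 (h (1 * y + 1))) t (t + 1)
  = RInt h (1 * t + 1) (1 * (t + 1) + 1))
  by (apply (RInt_comp_lin (V := R_CompleteNormedModule)); apply continuous_ex_RInt; auto).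
rewrite !Rmult_1_l in E1; rewrite <- E1.
rewrite (RInt_ext _ (fun y => plus (scal c (f y)) (scal d (g y)))).
2:{ intros y _; change (1 * h (1 * y + 1) = c * f y + d * g y).
    rewrite <- Hh, !Rmult_1_l; reflexivity. }
rewrite (RInt_plus (V := R_CompleteNormedModule)).
- rewrite !(RInt_scal (V := R_CompleteNormedModule)) by (apply continuous_ex_RInt; auto).
  reflexivity.
- apply (ex_RInt_scal (V := R_CompleteNormedModule)), continuous_ex_RInt; auto.
- apply (ex_RInt_scal (V := R_CompleteNormedModule)), continuous_ex_RInt; auto.
Qed.

Lemma continuous_mult_R (f g : R -> R) (x : R) :
  continuous f x -> continuous g x -> continuous (fun t => f t * g t) x.
Proof. intros; apply (continuous_mult (K := R_AbsRing)); auto. Qed.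

Lemma continuous_plus_R (f g : R -> R) (x : R) :
  continuous f x -> continuous g x -> continuous (fun t => f t + g t) x.
Proof. intros; apply (continuous_plus (V := R_NormedModule)); auto. Qed.

Lemma continuous_minus_R (f g : R -> R) (x : R) :
  continuous f x -> continuous g x -> continuous (fun t => f t - g t) x.
Proof. intros; apply (continuous_minus (V := R_NormedModule)); auto. Qed.

Lemma continuous_affine (c m : R) (f : R -> R) (x : R) :
  continuous f x -> continuous (fun t => c * f t + m) x.
Proof.
intros H; apply continuous_plus_R; [apply continuous_mult_R|]; auto using continuous_const.
Qed.

Lemma ex_derive_continuous_R (f : R -> R) (x l : R) :
  is_derive f x l -> continuous f x.
Proof.
intros H; apply (ex_derive_continuous (V := R_NormedModule)); exists l; exact H.
Qed.

Lemma Rabs_cos_sin_comb (x p q M : R) :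
  Rabs p <= M -> Rabs q <= M -> Rabs (p * cos x + q * sin x) <= 2 * M.
Proof.
intros Hp Hq.
pose proof (COS_bound x); pose proof (SIN_bound x).
apply Rabs_le_between in Hp; apply Rabs_le_between in Hq.
apply Rabs_le_between; nra.
Qed.

(** * Bloch solutions of one Hill equation *)

(** The differentiated function is the real part of [k (I + i J) exp (- i (2 S + phi))]; the phase
    contributes the factor [- 2 i w]. The imaginary part is the same formula with [(J, - I)] in
    place of [(I, J)]. *)
Lemma is_derive_rotation (k phi w di dj t : R) (I J S : R -> R) :
  is_derive I t di -> is_derive J t dj -> is_derive S t w ->
  is_derive (fun s => k * (I s * cos (2 * S s + phi) + J s * sin (2 * S s + phi))) t
    (2 * w * (k * (J t * cos (2 * S t + phi) + - I t * sin (2 * S t + phi))) +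
     k * (di * cos (2 * S t + phi) + dj * sin (2 * S t + phi))).
Proof.
intros HI HJ HS; auto_derive.
- repeat split; eexists; eauto.
- replace (Derive (fun x => I x) t) with di by (symmetry; apply is_derive_unique, HI).
  replace (Derive (fun x => J x) t) with dj by (symmetry; apply is_derive_unique, HJ).
  replace (Derive (fun x => S x) t) with w by (symmetry; apply is_derive_unique, HS).
  ring.
Qed.

(* With [r = a + i b] the system reads [r' = - 2 i w r - (i g / 2) (1 + r)^2];
   its periodic solution is the fixed point of
   [r |-> - 1 / (4 sin Phi) * int_t^(t+1) exp (i (2 S tau - 2 S t - Phi)) g (1 + r)^2 dtau]
   where [S' = w], [Phi = S (t + 1) - S t]. *)
Lemma small_periodic_solution (w g : R -> R) :
  (forall t, continuous w t) -> (forall t, continuous g t) ->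
  one_periodic w -> one_periodic g ->
  sin (RInt w 0 1) <> 0 ->
  (forall t, Rabs (g t) <= Rabs (sin (RInt w 0 1)) / 12) ->
  exists a b : R -> R,
    (forall t, is_derive a t (2 * w t * b t + g t * ((1 + a t) * b t))) /\
    (forall t, is_derive b t
       (- 2 * w t * a t - g t / 2 * ((1 + a t) ^ 2 - b t ^ 2))) /\
    one_periodic a /\ one_periodic b /\
    (forall t, Rabs (a t) <= 1 / 4) /\ (forall t, Rabs (b t) <= 1 / 4).
Proof.
intros Hw Hg Pw Pg Hs Hsm.
set (Phi := RInt w 0 1) in *.
set (S := fun t => RInt w 0 t).
assert (HS : forall t, is_derive S t (w t))
  by (intros; apply is_derive_primitive; auto).
assert (PS : forall t, S (t + 1) = S t + Phi)
  by (intros; apply RInt_add_period; auto).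
assert (CS : forall t, continuous S t)
  by (intros; eapply ex_derive_continuous_R; eauto).
set (k := - / (4 * sin Phi)).
(* A complex function [r] is coded as one real function on [bool * R], with [true] for the real part
   and [false] for the imaginary part. Then [P + i Q = (1 + r)^2],
   [F + i H = g (1 + r)^2 exp (2 i S)], and [T] is [k exp (- i (2 S + Phi))] times the window
   integral of [F + i H]. *)
set (P := fun (f : bool * R -> R) t => (1 + f (true, t)) ^ 2 - f (false, t) ^ 2).
set (Q := fun (f : bool * R -> R) t => 2 * ((1 + f (true, t)) * f (false, t))).
set (F := fun f t => g t * P f t * cos (2 * S t) + - (g t * Q f t) * sin (2 * S t)).
set (H := fun f t => g t * Q f t * cos (2 * S t) + g t * P f t * sin (2 * S t)).
set (T := fun f (x : bool * R) => let t := snd x in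
  let I := RInt (F f) t (t + 1) in let J := RInt (H f) t (t + 1) in
  k * (if fst x then I * cos (2 * S t + Phi) + J * sin (2 * S t + Phi)
       else J * cos (2 * S t + Phi) + - I * sin (2 * S t + Phi))).
set (K := fun f : bool * R -> R => (forall x, Rabs (f x) <= 1 / 4) /\
  (forall i t, f (i, t + 1) = f (i, t)) /\
  (forall i t, continuous (fun s => f (i, s)) t)).
assert (Ccos : forall t, continuous (fun s => cos (2 * S s)) t).
{ intros t; apply (continuous_comp (fun s => 2 * S s) cos).
  - apply continuous_mult_R; auto; apply continuous_const.
  - apply continuous_cos. }
assert (Csin : forall t, continuous (fun s => sin (2 * S s)) t).
{ intros t; apply (continuous_comp (fun s => 2 * S s) sin).
  - apply continuous_mult_R; auto; apply continuous_const.
  - apply continuous_sin. }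
assert (CP : forall f, K f -> forall t, continuous (P f) t).
{ intros f (_ & _ & Hc) t.
  apply (continuous_ext (fun t => (1 + f (true, t)) * (1 + f (true, t))
    - f (false, t) * f (false, t))).
  { intros s; unfold P; simpl; ring. }
  apply continuous_minus_R; apply continuous_mult_R; auto;
    apply continuous_plus_R; auto; apply continuous_const. }
assert (CQ : forall f, K f -> forall t, continuous (Q f) t).
{ intros f (_ & _ & Hc) t; unfold Q.
  apply continuous_mult_R; [apply continuous_const|].
  apply continuous_mult_R; auto.
  apply continuous_plus_R; auto; apply continuous_const. }
assert (CF : forall f, K f -> forall t, continuous (F f) t).
{ intros f Kf t; unfold F.
  apply continuous_plus_R; apply continuous_mult_R; auto.
  - apply continuous_mult_R; auto.
  - apply (continuous_opp (V := R_NormedModule)), continuous_mult_R; auto. }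
assert (CH : forall f, K f -> forall t, continuous (H f) t).
{ intros f Kf t; unfold H.
  apply continuous_plus_R; apply continuous_mult_R; auto;
  apply continuous_mult_R; auto. }
assert (PP : forall f, K f -> forall t, P f (t + 1) = P f t)
  by (intros f (_ & Hp & _) t; unfold P; rewrite !Hp; auto).
assert (PQ : forall f, K f -> forall t, Q f (t + 1) = Q f t)
  by (intros f (_ & Hp & _) t; unfold Q; rewrite !Hp; auto).
(* A unit shift multiplies [F + i H] by [exp (2 i Phi)]; the prefactor in [T] gains the inverse
   phase, so [T f] is periodic. *)
assert (shiftF : forall f, K f -> forall t,
  F f (t + 1) = cos (2 * Phi) * F f t + - sin (2 * Phi) * H f t).
{ intros f Kf t; unfold F, H.
  rewrite PP, PQ, Pg, PS by auto.
  replace (2 * (S t + Phi)) with (2 * S t + 2 * Phi) by ring.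
  rewrite cos_plus, sin_plus; ring. }
assert (shiftH : forall f, K f -> forall t,
  H f (t + 1) = cos (2 * Phi) * H f t + sin (2 * Phi) * F f t).
{ intros f Kf t; unfold F, H.
  rewrite PP, PQ, Pg, PS by auto.
  replace (2 * (S t + Phi)) with (2 * S t + 2 * Phi) by ring.
  rewrite cos_plus, sin_plus; ring. }
assert (PT : forall f, K f -> forall i t, T f (i, t + 1) = T f (i, t)).
{ intros f Kf i t; unfold T; simpl.
  rewrite (RInt_linear_window (F f) (H f) (F f) (cos (2 * Phi)) (- sin (2 * Phi)))
    by auto.
  rewrite (RInt_linear_window (H f) (F f) (H f) (cos (2 * Phi)) (sin (2 * Phi)))
    by auto.
  rewrite PS.
  replace (2 * (S t + Phi) + Phi) with ((2 * S t + Phi) + 2 * Phi) by ring.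
  rewrite (cos_plus _ (2 * Phi)), (sin_plus _ (2 * Phi)).
  pose proof (sin2_cos2 (2 * Phi)) as E; unfold Rsqr in E.
  set (c := cos (2 * Phi)) in *; set (s := sin (2 * Phi)) in *.
  set (I := RInt (F f) t (t + 1)); set (J := RInt (H f) t (t + 1)).
  set (C := cos (2 * S t + Phi)); set (D := sin (2 * S t + Phi)).
  destruct i.
  - transitivity (k * ((I * C + J * D) * (s * s + c * c))); [ring | rewrite E; ring].
  - transitivity (k * ((J * C - I * D) * (s * s + c * c))); [ring | rewrite E; ring]. }
(* This rests on [exp (2 i (S + Phi)) - exp (2 i S) = 2 i sin Phi exp (i (2 S + Phi))]. The
   prefactor of [T] cancels the last exponential and [k] cancels [sin Phi], leaving exactly the
   forcing term [- (i g / 2) (1 + r)^2]. *)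
assert (diffF : forall f, K f -> forall t, F f (t + 1) - F f t =
  - 2 * sin Phi * g t * (P f t * sin (2 * S t + Phi) + Q f t * cos (2 * S t + Phi))).
{ intros f Kf t; unfold F; rewrite PP, PQ, Pg, PS by auto.
  replace (2 * (S t + Phi)) with ((2 * S t + Phi) + Phi) by ring.
  replace (2 * S t) with ((2 * S t + Phi) - Phi) at 3 4 by ring.
  rewrite (sin_plus (2 * S t + Phi)), (cos_plus (2 * S t + Phi)), sin_minus, cos_minus; ring. }
assert (diffH : forall f, K f -> forall t, H f (t + 1) - H f t =
  2 * sin Phi * g t * (P f t * cos (2 * S t + Phi) - Q f t * sin (2 * S t + Phi))).
{ intros f Kf t; unfold H; rewrite PP, PQ, Pg, PS by auto.
  replace (2 * (S t + Phi)) with ((2 * S t + Phi) + Phi) by ring.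
  replace (2 * S t) with ((2 * S t + Phi) - Phi) at 3 4 by ring.
  rewrite (sin_plus (2 * S t + Phi)), (cos_plus (2 * S t + Phi)), sin_minus, cos_minus; ring. }
assert (DTa : forall f, K f -> forall t, is_derive (fun s => T f (true, s)) t
  (2 * w t * T f (false, t) + g t * ((1 + f (true, t)) * f (false, t)))).
{ intros f Kf t.
  pose proof (is_derive_rotation k Phi _ _ _ t _ _ S
    (is_derive_window _ t (CF f Kf)) (is_derive_window _ t (CH f Kf)) (HS t)) as D.
  eapply eq_ind; [exact D|]; clear D.
  rewrite diffF, diffH by auto; unfold T; simpl; apply Rplus_eq_compat_l.
  pose proof (sin2_cos2 (2 * S t + Phi)) as E; unfold Rsqr in E.
  set (c := cos (2 * S t + Phi)) in *; set (s := sin (2 * S t + Phi)) in *.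
  transitivity (k * sin Phi * (- 2 * g t * Q f t * (s * s + c * c))); [ring|].
  rewrite E; unfold k, Q; field; auto. }
assert (DTb : forall f, K f -> forall t, is_derive (fun s => T f (false, s)) t
  (- 2 * w t * T f (true, t) - g t / 2 * P f t)).
{ intros f Kf t.
  assert (DN : is_derive (fun s => - RInt (F f) s (s + 1)) t (- (F f (t + 1) - F f t)))
    by (apply (is_derive_opp (V := R_NormedModule)), is_derive_window; auto).
  pose proof (is_derive_rotation k Phi _ _ _ t _ _ S
    (is_derive_window _ t (CH f Kf)) DN (HS t)) as D.
  eapply eq_ind; [exact D|]; clear D.
  rewrite diffF, diffH by auto; unfold T; simpl.
  pose proof (sin2_cos2 (2 * S t + Phi)) as E; unfold Rsqr in E.
  set (c := cos (2 * S t + Phi)) in *; set (s := sin (2 * S t + Phi)) in *.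
  set (I := RInt (F f) t (t + 1)); set (J := RInt (H f) t (t + 1)).
  transitivity (2 * w t * (k * (- I * c - J * s))
    + k * sin Phi * (2 * g t * P f t * (s * s + c * c))); [ring|].
  rewrite E; unfold k; field; auto. }
assert (boundPQ : forall f, K f -> forall t, Rabs (P f t) <= 2 /\ Rabs (Q f t) <= 1).
{ intros f (Hb & _ & _) t.
  pose proof (Rabs_def2 _ _ (Rle_lt_trans _ _ (26/100) (Hb (true, t)) ltac:(lra))).
  pose proof (Rabs_def2 _ _ (Rle_lt_trans _ _ (26/100) (Hb (false, t)) ltac:(lra))).
  unfold P, Q; split; apply Rabs_le_between; nra. }
assert (s0 : 0 < Rabs (sin Phi)) by (apply Rabs_pos_lt; auto).
set (M := Rabs (sin Phi) / 12) in *.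
(* Here the constant 12 of the smallness hypothesis enters: [k] is [1 / (4 |sin Phi|)] in absolute
   value and [|g|] is at most [M = |sin Phi| / 12]. *)
assert (kM : Rabs k * M = / 48).
{ unfold k, M; rewrite Rabs_Ropp, Rabs_inv, Rabs_mult, (Rabs_pos_eq 4) by lra.
  field; lra. }
assert (kM' : forall c x, Rabs x <= c * M -> Rabs (k * x) <= c / 48).
{ intros c x Hx; rewrite Rabs_mult; pose proof (Rabs_pos k).
  apply Rle_trans with (Rabs k * (c * M)).
  - apply Rmult_le_compat_l; auto.
  - replace (Rabs k * (c * M)) with (c * (Rabs k * M)) by ring; rewrite kM; lra. }
assert (boundg : forall c t x, Rabs x <= c -> Rabs (g t * x) <= c * M).
{ intros c t x Hx; rewrite Rabs_mult, (Rmult_comm c).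
  apply Rmult_le_compat; auto using Rabs_pos. }
(* The bound 2 on [P] and [Q] is doubled by the cosine-sine combination inside the integral and
   again by the one outside, giving [8 / 48 <= 1 / 4]. *)
assert (boundT : forall f, K f -> forall x, Rabs (T f x) <= 1 / 4).
{ intros f Kf [i t]; unfold T; simpl.
  assert (BF : Rabs (RInt (F f) t (t + 1)) <= 2 * (2 * M)).
  { apply RInt_window_bound; auto; intros y; unfold F.
    destruct (boundPQ f Kf y); apply Rabs_cos_sin_comb; try rewrite Rabs_Ropp;
      apply boundg; lra. }
  assert (BH : Rabs (RInt (H f) t (t + 1)) <= 2 * (2 * M)).
  { apply RInt_window_bound; auto; intros y; unfold H.
    destruct (boundPQ f Kf y); apply Rabs_cos_sin_comb; apply boundg; lra. }
  apply Rle_trans with (8 / 48); [apply kM'|lra].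
  replace (8 * M) with (2 * (2 * (2 * M))) by ring.
  destruct i; apply Rabs_cos_sin_comb; try rewrite Rabs_Ropp; auto. }
assert (KT : forall f, K f -> K (T f)).
{ intros f Kf; repeat split; auto.
  intros [|] t; [eapply ex_derive_continuous_R, DTa | eapply ex_derive_continuous_R, DTb];
    auto. }
assert (lipPQ : forall f h e, K f -> K h -> (forall x, Rabs (f x - h x) <= e) ->
  forall t, Rabs (P f t - P h t) <= 3 * e /\ Rabs (Q f t - Q h t) <= 3 * e).
{ intros f h e (Hf & _ & _) (Hh & _ & _) He t.
  pose proof (proj1 (Rabs_le_between _ _) (Hf (true, t))).
  pose proof (proj1 (Rabs_le_between _ _) (Hf (false, t))).
  pose proof (proj1 (Rabs_le_between _ _) (Hh (true, t))).
  pose proof (proj1 (Rabs_le_between _ _) (Hh (false, t))).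
  pose proof (proj1 (Rabs_le_between _ _) (He (true, t))).
  pose proof (proj1 (Rabs_le_between _ _) (He (false, t))).
  unfold P, Q.
  set (a := f (true, t)) in *; set (b := f (false, t)) in *.
  set (c := h (true, t)) in *; set (d := h (false, t)) in *.
  split; apply Rabs_le_between; nra. }
(* The same two doublings turn the Lipschitz constant 3 of [P] and [Q] into [12 / 48 = 1 / 4], below
   the required [1 / 2]. *)
assert (lipT : forall f h e, K f -> K h -> (forall x, Rabs (f x - h x) <= e) ->
  forall x, Rabs (T f x - T h x) <= e / 2).
{ intros f h e Kf Kh He [i t]; unfold T; simpl.
  assert (BF : Rabs (RInt (F f) t (t + 1) - RInt (F h) t (t + 1)) <= 2 * (3 * e * M)).
  { apply RInt_window_dist; auto; intros y; unfold F.
    destruct (lipPQ f h e Kf Kh He y).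
    replace (_ - _) with ((g y * (P f y - P h y)) * cos (2 * S y)
      + - (g y * (Q f y - Q h y)) * sin (2 * S y)) by ring.
    apply Rabs_cos_sin_comb; try rewrite Rabs_Ropp; apply boundg; auto. }
  assert (BH : Rabs (RInt (H f) t (t + 1) - RInt (H h) t (t + 1)) <= 2 * (3 * e * M)).
  { apply RInt_window_dist; auto; intros y; unfold H.
    destruct (lipPQ f h e Kf Kh He y).
    replace (_ - _) with ((g y * (Q f y - Q h y)) * cos (2 * S y)
      + (g y * (P f y - P h y)) * sin (2 * S y)) by ring.
    apply Rabs_cos_sin_comb; apply boundg; auto. }
  assert (e0 : 0 <= e) by (eapply Rle_trans; [apply Rabs_pos | apply (He (true, t))]).
  rewrite <- Rmult_minus_distr_l.
  apply Rle_trans with (12 * e / 48); [apply kM'|lra].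
  replace (12 * e * M) with (2 * (2 * (3 * e * M))) by ring.
  set (I := RInt (F f) t (t + 1)) in *; set (I' := RInt (F h) t (t + 1)) in *.
  set (J := RInt (H f) t (t + 1)) in *; set (J' := RInt (H h) t (t + 1)) in *.
  destruct i.
  - replace (_ - _) with ((I - I') * cos (2 * S t + Phi) + (J - J') * sin (2 * S t + Phi))
      by ring.
    apply Rabs_cos_sin_comb; auto.
  - replace (_ - _) with ((J - J') * cos (2 * S t + Phi) + - (I - I') * sin (2 * S t + Phi))
      by ring.
    apply Rabs_cos_sin_comb; try rewrite Rabs_Ropp; auto. }
assert (Kcl : forall f, (forall e, 0 < e ->
  exists h, K h /\ forall x, Rabs (f x - h x) <= e) -> K f).
{ intros f Hf; repeat split.
  - intros x; apply le_epsilon; intros e He.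
    destruct (Hf e He) as (h & (Hb & _ & _) & Hh).
    replace (f x) with (h x + (f x - h x)) by ring.
    eapply Rle_trans; [apply Rabs_triang|]; apply Rplus_le_compat; auto.
  - intros i t; apply Rminus_diag_uniq, Rabs_eq_0, Rle_antisym; [|apply Rabs_pos].
    apply le_epsilon; intros e He.
    destruct (Hf (e / 2)) as (h & (_ & Hp & _) & Hh); [lra|].
    replace (_ - _) with ((f (i, t + 1) - h (i, t + 1)) - (f (i, t) - h (i, t)))
      by (rewrite Hp; ring).
    eapply Rle_trans; [apply Rabs_triang|]; rewrite Rabs_Ropp.
    pose proof (Hh (i, t)); pose proof (Hh (i, t + 1)); lra.
  - intros i t; apply continuous_uniform_limit; intros e He.
    destruct (Hf e He) as (h & (_ & _ & Hc) & Hh).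
    exists (fun s => h (i, s)); split; auto. }
assert (K0 : K (fun _ => 0)).
{ repeat split; auto; intros.
  - rewrite Rabs_R0; lra.
  - apply continuous_const. }
destruct (contraction_fixed_point _ K T (fun _ => 0) (1 / 4) K0) as (f & Kf & Tf);
  auto; [lra | | ].
{ intros x; rewrite Rminus_0_r; auto. }
exists (fun t => f (true, t)), (fun t => f (false, t)).
pose proof Kf as (Hb & Hp & Hc).
split; [|split; [|split; [|split; [|split]]]]; auto.
(* The derivative formulas for [T f] become the system itself once [T f] is replaced by [f]. *)
- intros t; apply (is_derive_ext (fun s => T f (true, s))); auto.
  rewrite <- (Tf (false, t)) at 1; auto.
- intros t; apply (is_derive_ext (fun s => T f (false, s))); auto.
  rewrite <- (Tf (true, t)) at 1; apply DTb; auto.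
- intros t; apply Hp.
- intros t; apply Hp.
Qed.

Definition is_derive_RC (f : R -> C) (x : R) (l : C) : Prop :=
  is_derive (fun t => Re (f t)) x (Re l) /\ is_derive (fun t => Im (f t)) x (Im l).

(** Nonvanishing is placed at the point [0], so a product of two such solutions is nonzero at the
    origin. *)
Definition bloch_solution (q : R -> R) (E : R -> C) : Prop :=
  (exists E' : R -> C,
    (forall x, is_derive_RC E x (E' x)) /\
    (forall x, is_derive_RC E' x (- (RtoC (q x) * E x))%C)) /\
  (exists M, forall x, Cmod (E x) <= M) /\
  E 0 <> RtoC 0 /\
  exists theta, quasi_periodic theta E.

Lemma Cexp_Ci (theta : R) : Cexp (Ci * RtoC theta) = (cos theta, sin theta).
Proof.
unfold Cexp; simpl.
replace (0 * theta - 1 * 0) with 0 by ring.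
replace (0 * 0 + 1 * theta) with theta by ring.
rewrite exp_0, !Rmult_1_l; reflexivity.
Qed.

(* [u + i v] is a solution [m] of the Riccati equation [m' + m^2 + q = 0]; the
   real part of [int m] integrates to [- ln v / 2], hence is periodic. *)
Lemma bloch_of_riccati (q u v : R -> R) (c : R) :
  0 < c -> (forall t, c <= v t) -> one_periodic v ->
  (forall t, is_derive v t (- 2 * u t * v t)) ->
  (forall t, is_derive u t (v t ^ 2 - u t ^ 2 - q t)) ->
  exists E, bloch_solution q E.
Proof.
intros c0 Hc Pv Dv Du.
assert (v0 : forall t, 0 < v t) by (intros t; eapply Rlt_le_trans; eauto).
assert (Cv : forall t, continuous v t)
  by (intros t; eapply ex_derive_continuous_R; eauto).
set (S := fun t => RInt v 0 t).
assert (DS : forall t, is_derive S t (v t))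
  by (intros; apply is_derive_primitive; auto).
assert (PS : forall t, S (t + 1) = S t + S 1)
  by (intros; apply RInt_add_period; auto).
(* [r] will be the modulus of the solution: [v' = - 2 u v] gives [r' = u r], and the lower bound on
   [v] bounds [r] above by [/ sqrt c]. *)
set (r := fun t => / sqrt (v t)).
assert (Dr : forall t, is_derive r t (u t * r t)).
{ intros t; unfold r; auto_derive.
  - assert (0 < sqrt (v t)) by (apply sqrt_lt_R0; auto).
    repeat split; auto; [eexists; eauto | lra].
  - replace (Derive (fun x => v x) t) with (- 2 * u t * v t)
      by (symmetry; apply is_derive_unique, Dv).
    assert (H : 0 < sqrt (v t)) by (apply sqrt_lt_R0; auto).
    replace (v t) with (sqrt (v t) * sqrt (v t)) at 1
      by (apply sqrt_sqrt; auto using Rlt_le).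
    field; lra. }
(* [y + i z = r exp (i S)] has logarithmic derivative [u + i v], which solves the Riccati
   equation. *)
set (y := fun t => r t * cos (S t)); set (z := fun t => r t * sin (S t)).
assert (Dy : forall t, is_derive y t (u t * y t - v t * z t)).
{ intros t; unfold y; auto_derive.
  - repeat split; eexists; eauto.
  - replace (Derive (fun x => r x) t) with (u t * r t)
      by (symmetry; apply is_derive_unique, Dr).
    replace (Derive (fun x => S x) t) with (v t)
      by (symmetry; apply is_derive_unique, DS).
    unfold z; ring. }
assert (Dz : forall t, is_derive z t (u t * z t + v t * y t)).
{ intros t; unfold z; auto_derive.
  - repeat split; eexists; eauto.
  - replace (Derive (fun x => r x) t) with (u t * r t)
      by (symmetry; apply is_derive_unique, Dr).
    replace (Derive (fun x => S x) t) with (v t)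
      by (symmetry; apply is_derive_unique, DS).
    unfold y; ring. }
exists (fun t => (y t, z t)); split; [|split; [|split]].
- exists (fun t => (u t * y t - v t * z t, u t * z t + v t * y t)); split.
  + intros t; split; simpl; auto.
  + intros t; split; simpl; auto_derive;
      try (repeat split; eexists; eauto; fail);
      replace (Derive (fun x => v x) t) with (- 2 * u t * v t)
        by (symmetry; apply is_derive_unique, Dv);
      replace (Derive (fun x => u x) t) with (v t ^ 2 - u t ^ 2 - q t)
        by (symmetry; apply is_derive_unique, Du);
      replace (Derive (fun x => y x) t) with (u t * y t - v t * z t)
        by (symmetry; apply is_derive_unique, Dy);
      replace (Derive (fun x => z x) t) with (u t * z t + v t * y t)
        by (symmetry; apply is_derive_unique, Dz);
      ring.
- exists (/ sqrt c); intros t; unfold Cmod; simpl.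
  replace (y t * (y t * 1) + z t * (z t * 1)) with (Rsqr (r t)).
  2:{ unfold y, z, Rsqr; pose proof (sin2_cos2 (S t)) as H; unfold Rsqr in H.
      transitivity (r t * r t * (sin (S t) * sin (S t) + cos (S t) * cos (S t)));
        [rewrite H|]; ring. }
  assert (0 < sqrt c) by (apply sqrt_lt_R0; auto).
  rewrite sqrt_Rsqr_abs, Rabs_pos_eq; unfold r.
  + apply Rinv_le_contravar; auto; apply sqrt_le_1_alt; auto.
  + apply Rlt_le, Rinv_0_lt_compat, sqrt_lt_R0; auto.
- intros H; apply (f_equal fst) in H; simpl in H; revert H; unfold y, S.
  rewrite RInt_point; change (zero : R) with 0; rewrite cos_0, Rmult_1_r.
  apply Rgt_not_eq, Rinv_0_lt_compat, sqrt_lt_R0; auto.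
(* The modulus is periodic, so over one period only the phase changes, by the integral of [v]. *)
- exists (S 1); intros t; rewrite Cexp_Ci.
  unfold Cmult, y, z; simpl.
  rewrite PS, sin_plus, cos_plus; unfold r; rewrite Pv; f_equal; ring.
Qed.

(* WKB: with [w = sqrt q] the functions [w^(-1/2) exp (+- i int w)] solve the
   equation up to a term governed by [g]; [r = a + i b] is the ratio of the two
   components of a true solution, and [u + i v] its logarithmic derivative
   [- w' / (2 w) + i w (1 - r) / (1 + r)]. *)
Lemma riccati_of_ratio (w w1 w2 a b : R -> R) (t : R) :
  let g := 3 / 4 * w1 t ^ 2 / w t ^ 3 - w2 t / (2 * w t ^ 2) in
  let d := fun s => (1 + a s) ^ 2 + b s ^ 2 in
  let v := fun s => w s * (1 - a s ^ 2 - b s ^ 2) / d s in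
  let u := fun s => - w1 s / (2 * w s) + 2 * w s * b s / d s in
  is_derive w t (w1 t) -> is_derive w1 t (w2 t) -> 0 < w t -> 0 < d t ->
  is_derive a t (2 * w t * b t + g * ((1 + a t) * b t)) ->
  is_derive b t (- 2 * w t * a t - g / 2 * ((1 + a t) ^ 2 - b t ^ 2)) ->
  is_derive v t (- 2 * u t * v t) /\
  is_derive u t (v t ^ 2 - u t ^ 2 - w t ^ 2).
Proof.
intros g d v u Dw Dw1 w0 d0 Da Db.
assert (Ew : Derive (fun x => w x) t = w1 t) by apply is_derive_unique, Dw.
assert (Ew1 : Derive (fun x => w1 x) t = w2 t) by apply is_derive_unique, Dw1.
pose proof (is_derive_unique _ _ _ Da : Derive (fun x => a x) t = _) as Ea.
pose proof (is_derive_unique _ _ _ Db : Derive (fun x => b x) t = _) as Eb.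
unfold d in d0.
split.
- unfold v, d; auto_derive.
  + repeat split; try (eexists; eauto; fail); lra.
  + rewrite Ew, Ea, Eb; unfold u, d, g; field; lra.
- unfold u, d; auto_derive.
  + repeat split; try (eexists; eauto; fail); lra.
  + rewrite Ew, Ew1, Ea, Eb; unfold v, d, g; field; lra.
Qed.

Lemma derive_one_periodic (f df : R -> R) :
  (forall x, is_derive f x (df x)) -> one_periodic f -> one_periodic df.
Proof.
intros Df Pf x.
rewrite <- (is_derive_unique _ _ _ (Df (x + 1))), <- (is_derive_unique _ _ _ (Df x)).
rewrite <- (Derive_n_comp_trans f 1 x 1 : Derive (fun y => f (y + 1)) x = Derive f (x + 1)).
apply Derive_ext, Pf.
Qed.

Lemma continuous_inv_R (f : R -> R) (x : R) :
  continuous f x -> f x <> 0 -> continuous (fun t => / f t) x.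
Proof.
intros Hf H0; apply (continuous_comp f Rinv); auto.
apply (ex_derive_continuous (V := R_NormedModule)); auto_derive; auto.
Qed.

Lemma continuous_pow_R (f : R -> R) (n : nat) (x : R) :
  continuous f x -> continuous (fun t => f t ^ n) x.
Proof.
intros Hf; apply (continuous_comp f (fun y => y ^ n)); auto.
apply (ex_derive_continuous (V := R_NormedModule)); auto_derive; auto.
Qed.

Lemma continuous_sqrt_R (f : R -> R) (x : R) :
  continuous f x -> continuous (fun t => sqrt (f t)) x.
Proof. intros Hf; apply (continuous_comp f sqrt); auto; apply continuous_sqrt. Qed.

(** The expression is the WKB error [g] rewritten through [q = w^2] and its derivatives. With [w] at
    least of order [L] and [q1], [q2] at most of order [L^2], both terms are of order [1 / L]; the
    constant is [5/16 * 32 + 8/4 = 12]. *)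
Lemma wkb_error_bound (w q1 q2 C L : R) :
  1 <= C -> 0 < L -> L / (2 * C) <= w ->
  Rabs q1 <= C * L ^ 2 -> Rabs q2 <= C * L ^ 2 ->
  Rabs (5 / 16 * q1 ^ 2 / w ^ 5 - q2 / (4 * w ^ 3)) <= 12 * C ^ 7 / L.
Proof.
intros HC HL Hw H1 H2.
assert (l0 : 0 < L / (2 * C)) by (apply Rdiv_lt_0_compat; lra).
set (p := / w).
assert (p0 : 0 < p) by (apply Rinv_0_lt_compat; lra).
assert (Hp : p <= 2 * C / L).
{ replace (2 * C / L) with (/ (L / (2 * C))) by (field; lra).
  apply Rinv_le_contravar; auto. }
replace (5 / 16 * q1 ^ 2 / w ^ 5 - q2 / (4 * w ^ 3))
  with (5 / 16 * q1 ^ 2 * p ^ 5 + - (/ 4 * (q2 * p ^ 3))) by (unfold p; field; lra).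
assert (A : q1 ^ 2 * p ^ 5 <= (C * L ^ 2) ^ 2 * (2 * C / L) ^ 5).
{ apply Rmult_le_compat; [apply pow2_ge_0 | apply pow_le; lra | |].
  - rewrite <- pow2_abs; apply pow_incr; split; auto using Rabs_pos.
  - apply pow_incr; lra. }
assert (B : Rabs (q2 * p ^ 3) <= (C * L ^ 2) * (2 * C / L) ^ 3).
{ rewrite Rabs_mult, (Rabs_pos_eq (p ^ 3)) by (apply pow_le; lra).
  apply Rmult_le_compat; auto using Rabs_pos.
  - apply pow_le; lra.
  - apply pow_incr; lra. }
replace ((C * L ^ 2) ^ 2 * (2 * C / L) ^ 5) with (32 * (C ^ 7 / L)) in A by (field; lra).
replace ((C * L ^ 2) * (2 * C / L) ^ 3) with (8 * (C ^ 4 / L)) in B by (field; lra).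
assert (E : C ^ 4 / L <= C ^ 7 / L).
{ apply Rmult_le_compat_r; [apply Rlt_le, Rinv_0_lt_compat; auto|].
  apply Rle_pow; auto. }
assert (F : 0 <= q1 ^ 2 * p ^ 5)
  by (apply Rmult_le_pos; [apply pow2_ge_0 | apply pow_le; lra]).
replace (12 * C ^ 7 / L) with (12 * (C ^ 7 / L)) by (field; lra).
apply Rabs_le_between in B; apply Rabs_le_between; lra.
Qed.

(** [L] stands for [sqrt lambda]. The threshold comes from requiring [12 * C ^ 7 / L] to be at most
    one twelfth of the lower bound [/ (32 * C ^ 2)] on the sine: [12 * 12 * 32 = 4608]. *)
Lemma bloch_solution_exists (q q1 q2 : R -> R) (C L : R) :
  1 <= C -> 4608 * C ^ 9 <= L ->
  (forall x, is_derive q x (q1 x)) -> (forall x, is_derive q1 x (q2 x)) ->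
  (forall x, continuous q2 x) -> one_periodic q ->
  (forall x, (L / (2 * C)) ^ 2 <= q x) ->
  (forall x, Rabs (q1 x) <= C * L ^ 2) -> (forall x, Rabs (q2 x) <= C * L ^ 2) ->
  / (32 * C ^ 2) <= Rabs (sin (RInt (fun x => sqrt (q x)) 0 1)) ->
  exists E, bloch_solution q E.
Proof.
intros HC HL Dq Dq1 Cq2 Pq Hq Hq1 Hq2 Hsin.
assert (C9 : 1 <= C ^ 9) by (apply pow_R1_Rle; auto).
assert (l0 : 0 < L / (2 * C)) by (apply Rdiv_lt_0_compat; lra).
set (w := fun x => sqrt (q x)) in *.
assert (ww : forall x, w x ^ 2 = q x).
{ intros x; apply pow2_sqrt; eapply Rle_trans; [apply pow2_ge_0 | apply Hq]. }
assert (wl : forall x, L / (2 * C) <= w x).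
{ intros x; unfold w; rewrite <- (sqrt_pow2 (L / (2 * C))) by lra.
  apply sqrt_le_1_alt; auto. }
assert (w0 : forall x, 0 < w x) by (intros x; specialize (wl x); lra).
assert (q0 : forall x, 0 < q x) by (intros x; rewrite <- ww; apply pow_lt; auto).
set (w1 := fun x => q1 x / (2 * w x)).
set (w2 := fun x => q2 x / (2 * w x) - q1 x ^ 2 / (4 * w x ^ 3)).
assert (Dw : forall x, is_derive w x (w1 x)).
{ intros x; unfold w; auto_derive.
  - repeat split; auto; eexists; eauto.
  - replace (Derive (fun x => q x) x) with (q1 x)
      by (symmetry; apply is_derive_unique, Dq).
    pose proof (w0 x); unfold w1; fold (w x); field; lra. }
assert (Dw1 : forall x, is_derive w1 x (w2 x)).
{ intros x; pose proof (w0 x); unfold w1; auto_derive.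
  - repeat split; try (eexists; eauto; fail); lra.
  - replace (Derive (fun x => q1 x) x) with (q2 x)
      by (symmetry; apply is_derive_unique, Dq1).
    replace (Derive (fun x => w x) x) with (w1 x)
      by (symmetry; apply is_derive_unique, Dw).
    unfold w2, w1; field; lra. }
set (g := fun x => 3 / 4 * w1 x ^ 2 / w x ^ 3 - w2 x / (2 * w x ^ 2)).
(* Substituting [w1] and [w2] into [g] gives coefficient [3/16 + 1/8 = 5/16] for the square of
   [q1]. *)
set (g' := fun x => 5 / 16 * q1 x ^ 2 / w x ^ 5 - q2 x / (4 * w x ^ 3)).
assert (gg : forall x, g' x = g x).
{ intros x; pose proof (w0 x); unfold g, g', w2, w1; field; lra. }
assert (Cw : forall x, continuous w x)
  by (intros x; eapply ex_derive_continuous_R; eauto).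
assert (Cq1 : forall x, continuous q1 x)
  by (intros x; eapply ex_derive_continuous_R; eauto).
assert (Cg : forall x, continuous g x).
{ intros x; apply (continuous_ext g'); auto; unfold g', Rdiv.
  apply continuous_minus_R; apply continuous_mult_R;
    try (apply continuous_inv_R; [|apply Rgt_not_eq, Rlt_gt]); auto.
  - apply continuous_mult_R; [apply continuous_const | apply continuous_pow_R; auto].
  - apply continuous_pow_R; auto.
  - apply pow_lt; auto.
  - apply continuous_mult_R; [apply continuous_const | apply continuous_pow_R; auto].
  - apply Rmult_lt_0_compat; [lra | apply pow_lt; auto]. }
assert (Pq1 : one_periodic q1) by (eapply derive_one_periodic; eauto).
assert (Pq2 : one_periodic q2) by (eapply derive_one_periodic; eauto).
assert (Pw : one_periodic w) by (intros x; unfold w; rewrite Pq; auto).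
assert (Pg : one_periodic g).
{ intros x; rewrite <- !gg; unfold g'; rewrite Pw, Pq1, Pq2; auto. }
assert (C2 : 0 < / (32 * C ^ 2))
  by (apply Rinv_0_lt_compat; apply Rmult_lt_0_compat; [lra | apply pow_lt; lra]).
destruct (small_periodic_solution w g) as (a & b & Da & Db & Pa & Pb & Ba & Bb); auto.
{ intros H; rewrite H, Rabs_R0 in Hsin; lra. }
{ intros x; rewrite <- gg.
  apply Rle_trans with (12 * C ^ 7 / L); [apply wkb_error_bound; auto; lra|].
  apply Rle_trans with (/ (32 * C ^ 2) / 12); [|lra].
  apply Rmult_le_reg_r with (384 * C ^ 2 * L).
  - repeat apply Rmult_lt_0_compat; try apply pow_lt; lra.
  - replace (/ (32 * C ^ 2) / 12 * (384 * C ^ 2 * L)) with L by (field; lra).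
    replace (12 * C ^ 7 / L * (384 * C ^ 2 * L)) with (4608 * C ^ 9) by (field; lra).
    auto. }
(* These bounds give [v >= w / 4], whence the lower bound [L / (2 * C) / 4] used below. *)
assert (ab : forall x, 0 < (1 + a x) ^ 2 + b x ^ 2 <= 2 /\ 1 / 2 <= 1 - a x ^ 2 - b x ^ 2).
{ intros x; specialize (Ba x); specialize (Bb x).
  apply Rabs_le_between in Ba; apply Rabs_le_between in Bb; nra. }
pose proof (fun x => riccati_of_ratio w w1 w2 a b x (Dw x) (Dw1 x) (w0 x)
  (proj1 (proj1 (ab x))) (Da x) (Db x)) as Ric; simpl in Ric.
eapply bloch_of_riccati with (c := L / (2 * C) / 4)
  (v := fun s => w s * (1 - a s ^ 2 - b s ^ 2) / ((1 + a s) ^ 2 + b s ^ 2)).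
- lra.
- intros t; destruct (ab t) as [[d0 d2] n2]; specialize (wl t).
  apply Rmult_le_reg_r with ((1 + a t) ^ 2 + b t ^ 2); auto.
  replace (w t * (1 - a t ^ 2 - b t ^ 2) / ((1 + a t) ^ 2 + b t ^ 2)
    * ((1 + a t) ^ 2 + b t ^ 2)) with (w t * (1 - a t ^ 2 - b t ^ 2)) by (field; lra).
  set (l := L / (2 * C)) in *.
  set (d := (1 + a t) ^ 2 + b t ^ 2) in *; set (n := 1 - a t ^ 2 - b t ^ 2) in *.
  nra.
- intros t; rewrite Pw, Pa, Pb; auto.
- intros t; apply Ric.
- intros t; rewrite <- ww; apply Ric.
Qed.

(** * Choice of the separation constant *)

(** Follows from the Taylor bound [sin x >= x - x^3 / 6]. *)
Lemma half_le_sin (x : R) : 0 <= x <= 1 -> x / 2 <= sin x.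
Proof.
intros Hx.
pose proof (proj1 (pre_sin_bound x 0 ltac:(lra) ltac:(lra))) as H.
unfold sin_approx, sin_term in H; simpl in H; field_simplify in H.
nra.
Qed.

(** Factor [d = (sqrt y - sqrt x) * (sqrt y + sqrt x)]; the second factor lies between [2 * A] and
    [2 * B]. *)
Lemma sqrt_gap (x y d A B : R) :
  0 < A -> A ^ 2 <= x <= B ^ 2 -> A ^ 2 <= y <= B ^ 2 -> 0 < B -> y - x = d -> 0 <= d ->
  d / (2 * B) <= sqrt y - sqrt x <= d / (2 * A).
Proof.
intros HA Hx Hy HB Hd d0.
assert (bd : forall z, A ^ 2 <= z <= B ^ 2 -> A <= sqrt z <= B).
{ intros z Hz; rewrite <- (sqrt_pow2 A), <- (sqrt_pow2 B) by lra.
  split; apply sqrt_le_1_alt; lra. }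
pose proof (pow_lt A 2 HA).
pose proof (bd x Hx); pose proof (bd y Hy).
assert (E : d = (sqrt y - sqrt x) * (sqrt y + sqrt x)).
{ rewrite <- Hd, <- (sqrt_sqrt x), <- (sqrt_sqrt y) at 1 by lra; ring. }
set (s := sqrt x) in *; set (t := sqrt y) in *.
assert (0 <= t - s) by nra.
split.
- apply Rmult_le_reg_r with (2 * B); [lra|].
  replace (d / (2 * B) * (2 * B)) with d by (field; lra).
  rewrite E; apply Rmult_le_compat_l; lra.
- apply Rmult_le_reg_r with (2 * A); [lra|].
  replace (d / (2 * A) * (2 * A)) with d by (field; lra).
  rewrite E; apply Rmult_le_compat_l; lra.
Qed.

(** The two phases differ by at least [e = / (8 * C ^ 2)] and at most 1, so the sine of their
    difference is at least [e / 2]. By the subtraction formula the two sines cannot both be below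
    [e / 4] in absolute value. *)
Lemma phase_gap (p q : R -> R) (C L d : R) :
  1 <= C -> 0 < L ->
  (forall x, continuous p x) -> (forall x, continuous q x) ->
  (forall x, (L / (2 * C)) ^ 2 <= p x <= (2 * C * L) ^ 2) ->
  (forall x, (L / (2 * C)) ^ 2 <= q x <= (2 * C * L) ^ 2) ->
  (forall x, q x - p x = d) -> L / (2 * C) <= d <= L / C ->
  / (32 * C ^ 2) <= Rabs (sin (RInt (fun x => sqrt (p x)) 0 1)) \/
  / (32 * C ^ 2) <= Rabs (sin (RInt (fun x => sqrt (q x)) 0 1)).
Proof.
intros HC HL Cp Cq Bp Bq Hd Bd.
assert (l0 : 0 < L / (2 * C)) by (apply Rdiv_lt_0_compat; lra).
assert (gap : forall x, / (8 * C ^ 2) <= sqrt (q x) - sqrt (p x) <= 1).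
{ intros x.
  destruct (sqrt_gap (p x) (q x) d (L / (2 * C)) (2 * C * L)) as [G1 G2];
    auto; try nra.
  split; [eapply Rle_trans; [|exact G1] | eapply Rle_trans; [exact G2|]].
  - replace (/ (8 * C ^ 2)) with (L / (2 * C) / (2 * (2 * C * L))) by (field; lra).
    apply Rmult_le_compat_r; [apply Rlt_le, Rinv_0_lt_compat; nra | lra].
  - apply Rmult_le_reg_r with (2 * (L / (2 * C))); [lra|].
    replace (d / (2 * (L / (2 * C))) * (2 * (L / (2 * C)))) with d by (field; lra).
    replace (1 * (2 * (L / (2 * C)))) with (L / C) by (field; lra); lra. }
set (fp := fun x => sqrt (p x)) in *; set (fq := fun x => sqrt (q x)) in *.
assert (Cfp : forall x, continuous fp x) by (intros; apply continuous_sqrt_R; auto).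
assert (Cfq : forall x, continuous fq x) by (intros; apply continuous_sqrt_R; auto).
assert (D : RInt fq 0 1 - RInt fp 0 1 = RInt (fun x => fq x - fp x) 0 1).
{ symmetry; apply (RInt_minus (V := R_CompleteNormedModule));
    apply continuous_ex_RInt; auto. }
assert (Ed : ex_RInt (fun x => fq x - fp x) 0 1)
  by (apply continuous_ex_RInt; intros; apply continuous_minus_R; auto).
assert (D1 : / (8 * C ^ 2) <= RInt fq 0 1 - RInt fp 0 1 <= 1).
{ rewrite D; split.
  - replace (/ (8 * C ^ 2)) with (RInt (fun _ => / (8 * C ^ 2)) 0 1)
      by (rewrite RInt_const; unfold scal; simpl; unfold mult; simpl; lra).
    apply RInt_le; auto; [lra | apply ex_RInt_const | intros; apply gap].
  - replace 1 with (RInt (fun _ => 1) 0 1) at 2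
      by (rewrite RInt_const; unfold scal; simpl; unfold mult; simpl; lra).
    apply RInt_le; auto; [lra | apply ex_RInt_const | intros; apply gap]. }
set (x := RInt fp 0 1) in *; set (y := RInt fq 0 1) in *.
assert (c0 : 0 < / (8 * C ^ 2)) by (apply Rinv_0_lt_compat; nra).
replace (/ (32 * C ^ 2)) with (/ (8 * C ^ 2) / 4) by (field; lra).
set (e := / (8 * C ^ 2)) in *.
assert (S1 : e / 2 <= sin (y - x)).
{ apply Rle_trans with ((y - x) / 2); [lra | apply half_le_sin; lra]. }
rewrite sin_minus in S1.
pose proof (COS_bound x); pose proof (COS_bound y).
destruct (Rle_dec (e / 4) (Rabs (sin x))) as [|Nx]; [left; auto|].
destruct (Rle_dec (e / 4) (Rabs (sin y))) as [|Ny]; [right; auto|].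
exfalso.
apply Rnot_le_lt in Nx; apply Rnot_le_lt in Ny.
assert (M : forall u v, Rabs u < e / 4 -> -1 <= v <= 1 -> Rabs (u * v) < e / 4).
{ intros u v Hu Hv; rewrite Rabs_mult.
  apply Rle_lt_trans with (Rabs u * 1); [|lra].
  apply Rmult_le_compat_l; [apply Rabs_pos | apply Rabs_le_between; lra]. }
pose proof (M (sin y) (cos x) Ny ltac:(lra)) as My.
pose proof (M (sin x) (cos y) Nx ltac:(lra)) as Mx.
apply Rabs_def2 in Mx; apply Rabs_def2 in My; lra.
Qed.

Lemma common_good_index (P Q : nat -> Prop) :
  (forall i j, (i < j <= 2)%nat -> P i \/ P j) ->
  (forall i j, (i < j <= 2)%nat -> Q i \/ Q j) ->
  exists i, (i <= 2)%nat /\ P i /\ Q i.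
Proof.
intros HP HQ.
pose proof (HP 0 1 ltac:(lia))%nat; pose proof (HP 0 2 ltac:(lia))%nat.
pose proof (HP 1 2 ltac:(lia))%nat; pose proof (HQ 0 1 ltac:(lia))%nat.
pose proof (HQ 0 2 ltac:(lia))%nat; pose proof (HQ 1 2 ltac:(lia))%nat.
destruct (classic (P 0%nat /\ Q 0%nat)) as [[]|]; [exists 0%nat; auto|].
destruct (classic (P 1%nat /\ Q 1%nat)) as [[]|]; [exists 1%nat; auto|].
exists 2%nat; split; [lia | tauto].
Qed.

(** * The maximum of the coefficient values *)

Lemma one_periodic_IZR (f : R -> R) (x : R) (z : Z) :
  one_periodic f -> f (x + IZR z) = f x.
Proof.
intros Pf.
assert (H : forall n y, f (y + INR n) = f y).
{ induction n as [|n IH]; intros y; [simpl; rewrite Rplus_0_r; auto|].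
  rewrite S_INR, <- Rplus_assoc, Pf; auto. }
destruct (Z_le_gt_dec 0 z) as [Hz|Hz].
- rewrite <- (Z2Nat.id z), <- INR_IZR_INZ by lia; auto.
- replace z with (- Z.of_nat (Z.to_nat (- z)))%Z by lia.
  rewrite opp_IZR, <- INR_IZR_INZ.
  rewrite <- (H (Z.to_nat (- z)) (x + _)); f_equal; ring.
Qed.

Lemma periodic_range_maximum (f : R -> R) :
  (forall x, continuous f x) -> one_periodic f ->
  exists m, is_maximum (fun v => exists x, v = f x) m.
Proof.
intros Cf Pf.
destruct (continuity_ab_maj f 0 1) as (x0 & Hx0 & _); [lra| |].
{ intros c _; apply continuity_pt_filterlim; apply Cf. }
exists (f x0); split; [eauto|].
intros v [x ->].
replace x with (frac_part x + IZR (Int_part x)) by (unfold frac_part; ring).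
rewrite one_periodic_IZR by auto.
apply Hx0; destruct (base_fp x); lra.
Qed.

Lemma maximum_union (A B : R -> Prop) :
  (exists m, is_maximum A m) -> (exists m, is_maximum B m) ->
  exists m, is_maximum (fun v => A v \/ B v) m.
Proof.
intros [m [Am Hm]] [n [Bn Hn]].
destruct (Rle_dec m n); [exists n | exists m]; split; auto;
  intros v [Hv|Hv]; try apply Hm in Hv; try apply Hn in Hv; lra.
Qed.

Lemma C2_smooth_derive (f : R -> R) :
  C2_smooth f ->
  (forall x, is_derive f x (Derive_n f 1 x)) /\
  (forall x, is_derive (Derive_n f 1) x (Derive_n f 2 x)) /\
  (forall x, continuous (Derive_n f 2) x).
Proof.
intros [H C]; split; [|split]; auto; intros x; apply Derive_correct.
- apply (H 1%nat x); lia.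
- apply (H 2%nat x); lia.
Qed.

(** The set is the union of the ranges of eight continuous periodic functions, each attaining its
    maximum on one period; positivity makes the reciprocals continuous. *)
Lemma coefficient_values_maximum (f1 f2 : R -> R) :
  C2_smooth f1 -> C2_smooth f2 ->
  (forall x, 0 < f1 x) -> (forall x, 0 < f2 x) ->
  one_periodic f1 -> one_periodic f2 ->
  exists m, is_maximum (coefficient_values f1 f2) m.
Proof.
intros S1 S2 p1 p2 P1 P2.
assert (H : forall f, C2_smooth f -> (forall x, 0 < f x) -> one_periodic f ->
  exists m, is_maximum (fun v => exists x, v = Rabs (f x) \/
    v = Rabs (Derive_n f 1 x) \/ v = Rabs (Derive_n f 2 x) \/ v = Rabs (/ f x)) m).
{ intros f S p P; destruct (C2_smooth_derive f S) as (D1 & D2 & C2).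
  assert (P' : one_periodic (Derive_n f 1)) by (eapply derive_one_periodic; eauto).
  assert (P'' : one_periodic (Derive_n f 2)) by (eapply derive_one_periodic; eauto).
  assert (M : forall h, (forall x, continuous h x) -> one_periodic h ->
    exists m, is_maximum (fun v => exists x, v = Rabs (h x)) m).
  { intros h Ch Ph; apply periodic_range_maximum.
    - intros x; apply continuous_Rabs_comp; auto.
    - intros x; rewrite Ph; auto. }
  assert (C0 : forall x, continuous f x)
    by (intros; eapply ex_derive_continuous_R; eauto).
  assert (C1 : forall x, continuous (Derive_n f 1) x)
    by (intros; eapply ex_derive_continuous_R; eauto).
  destruct (maximum_union _ _ (M f C0 P) (maximum_union _ _ (M _ C1 P')
    (maximum_union _ _ (M _ C2 P'') (M (fun x => / f x)
      (fun x => continuous_inv_R f x (C0 x) (Rgt_not_eq _ _ (p x)))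
      (fun x => f_equal Rinv (P x)))))) as [m [Hm Um]].
  exists m; split.
  - destruct Hm as [[x E]|[[x E]|[[x E]|[x E]]]]; exists x; auto.
  - intros v [x [E|[E|[E|E]]]]; apply Um; eauto. }
destruct (maximum_union _ _ (H f1 S1 p1 P1) (H f2 S2 p2 P2)) as [m [Hm Um]].
exists m; split.
- destruct Hm as [[x E]|[x E]]; [exists f1, x | exists f2, x]; auto.
- intros v (f & x & [-> | ->] & E); apply Um; eauto.
Qed.

(** * Products of functions of one variable *)

(** Derivatives enter as witnesses, so the ones furnished by the Hill equation can be supplied
    directly. *)
Fixpoint Ck_line (k : nat) (f : R -> C) : Prop :=
  match k with
  | O => (forall x, continuous (fun t => Re (f t)) x) /\
         (forall x, continuous (fun t => Im (f t)) x)
  | S k => exists f', (forall x, is_derive_RC f x (f' x)) /\ Ck_line k f'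
  end.

Lemma Ck_line_pred (k : nat) (f : R -> C) : Ck_line (S k) f -> Ck_line k f.
Proof.
revert f; induction k as [|k IH]; intros f [f' [D H]].
- split; intros x;
    [exact (ex_derive_continuous_R _ _ _ (proj1 (D x)))
    | exact (ex_derive_continuous_R _ _ _ (proj2 (D x)))].
- exists f'; auto.
Qed.

Lemma is_derive_RC_Cmult (f : R -> C) (c l : C) (x : R) :
  is_derive_RC f x l -> is_derive_RC (fun t => (f t * c)%C) x (l * c)%C.
Proof.
intros [D1 D2]; split; simpl.
- apply (is_derive_minus (V := R_NormedModule)
    (fun t => fst (f t) * fst c) (fun t => snd (f t) * snd c));
    apply (is_derive_scal_l (K := R_AbsRing) (V := R_NormedModule)); assumption.
- apply (is_derive_plus (V := R_NormedModule)
    (fun t => fst (f t) * snd c) (fun t => snd (f t) * fst c));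
    apply (is_derive_scal_l (K := R_AbsRing) (V := R_NormedModule)); assumption.
Qed.

Lemma Derive_RC_unique (f : R -> C) (x : R) (l : C) :
  is_derive_RC f x l -> Derive_RC f x = l.
Proof.
intros [D1 D2]; apply injective_projections; apply is_derive_unique; assumption.
Qed.

(** Componentwise derivatives recombine by writing [f] as [Re f] times [(1, 0)] plus [Im f] times
    [(0, 1)]. *)
Lemma is_derive_RC_ex (f : R -> C) (x : R) (l : C) :
  is_derive_RC f x l -> ex_derive_RC f x.
Proof.
intros [D1 D2].
exists (plus (scal (Re l) ((1, 0) : C_R_NormedModule))
  (scal (Im l) ((0, 1) : C_R_NormedModule))).
apply (is_derive_ext (V := C_R_NormedModule)
  (fun t => plus (scal (Re (f t)) ((1, 0) : C_R_NormedModule))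
                 (scal (Im (f t)) ((0, 1) : C_R_NormedModule)))).
- intros t; rewrite (surjective_pairing (f t)).
  unfold plus, scal; simpl; unfold prod_plus, prod_scal, plus, scal; simpl;
    unfold mult; simpl.
  f_equal; ring.
- apply (is_derive_plus (V := C_R_NormedModule)).
  + exact (is_derive_scal_l (V := C_R_NormedModule) _ x (Re l) (1, 0) D1).
  + exact (is_derive_scal_l (V := C_R_NormedModule) _ x (Im l) (0, 1) D2).
Qed.

Definition tensor (f h : R -> C) (p : R * R) : C := (f (fst p) * h (snd p))%C.

Lemma is_derive_RC_tensor1 (f f' h : R -> C) (x y : R) :
  is_derive_RC f x (f' x) ->
  is_derive_RC (fun t => tensor f h (t, y)) x (tensor f' h (x, y)).
Proof. exact (is_derive_RC_Cmult f (h y) (f' x) x). Qed.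

Lemma is_derive_RC_tensor2 (f h h' : R -> C) (x y : R) :
  is_derive_RC h y (h' y) ->
  is_derive_RC (fun t => tensor f h (x, t)) y (tensor f h' (x, y)).
Proof.
intros D; unfold tensor; simpl; rewrite (Cmult_comm (f x)).
replace (fun t => _) with (fun t => (h t * f x)%C)
  by (apply functional_extensionality; intros; apply Cmult_comm).
exact (is_derive_RC_Cmult h (f x) (h' y) y D).
Qed.

Lemma partial1_tensor (f f' h : R -> C) :
  (forall x, is_derive_RC f x (f' x)) -> partial1 (tensor f h) = tensor f' h.
Proof.
intros D; apply functional_extensionality; intros [x y].
exact (Derive_RC_unique _ _ _ (is_derive_RC_tensor1 f f' h x y (D x))).
Qed.

Lemma partial2_tensor (f h h' : R -> C) :
  (forall x, is_derive_RC h x (h' x)) -> partial2 (tensor f h) = tensor f h'.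
Proof.
intros D; apply functional_extensionality; intros [x y].
exact (Derive_RC_unique _ _ _ (is_derive_RC_tensor2 f h h' x y (D y))).
Qed.

(** A partial derivative differentiates one factor and keeps the other, so it is again a tensor;
    [Ck_line_pred] lowers the order of the untouched factor to match. *)
Lemma Ck_plane_tensor (k : nat) (f h : R -> C) :
  Ck_line k f -> Ck_line k h -> Ck_plane k (tensor f h).
Proof.
revert f h; induction k as [|k IH]; intros f h Hf Hh.
- destruct Hf as [Cf1 Cf2]; destruct Hh as [Ch1 Ch2]; intros p.
  assert (G : forall (u v : R -> R), (forall x, continuous u x) ->
    (forall x, continuous v x) ->
    continuous (fun q : prod_UniformSpace R_UniformSpace R_UniformSpace =>
      u (fst q) * v (snd q)) p).
  { intros u v Hu Hv.
    apply (continuous_mult (K := R_AbsRing)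
      (fun q : prod_UniformSpace R_UniformSpace R_UniformSpace => u (fst q))
      (fun q : prod_UniformSpace R_UniformSpace R_UniformSpace => v (snd q))).
    - apply (continuous_comp (fun q : prod_UniformSpace R_UniformSpace R_UniformSpace => fst q) u);
        auto; apply continuous_fst.
    - apply (continuous_comp (fun q : prod_UniformSpace R_UniformSpace R_UniformSpace => snd q) v);
        auto; apply continuous_snd. }
  pose proof (continuous_minus (V := R_NormedModule) _ _ _ (G _ _ Cf1 Ch1) (G _ _ Cf2 Ch2)) as A.
  pose proof (continuous_plus (V := R_NormedModule) _ _ _ (G _ _ Cf1 Ch2) (G _ _ Cf2 Ch1)) as B.
  apply filterlim_locally; intros e.
  apply (filter_and _ _ (proj1 (filterlim_locally _ _) A e)
    (proj1 (filterlim_locally _ _) B e)).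
- pose proof (Ck_line_pred _ _ Hf) as Kf; pose proof (Ck_line_pred _ _ Hh) as Kh.
  destruct Hf as [f' [Df Kf']]; destruct Hh as [h' [Dh Kh']].
  cbn [Ck_plane]; split; [|split; [|split]].
  + intros [x y].
    exact (is_derive_RC_ex _ _ _ (is_derive_RC_tensor1 f f' h x y (Df x))).
  + intros [x y].
    exact (is_derive_RC_ex _ _ _ (is_derive_RC_tensor2 f h h' x y (Dh y))).
  + rewrite (partial1_tensor _ _ _ Df); auto.
  + rewrite (partial2_tensor _ _ _ Dh); auto.
Qed.

(** The equation itself gives the second derivative as [- q E], a product of continuous
    functions. *)
Lemma bloch_solution_Ck_line (q : R -> R) (E E' : R -> C) :
  (forall x, continuous q x) ->
  (forall x, is_derive_RC E x (E' x)) ->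
  (forall x, is_derive_RC E' x (- (RtoC (q x) * E x))%C) ->
  Ck_line 2 E.
Proof.
intros Cq D D'.
exists E'; split; auto; eexists; split; [exact D'|].
split; intros x; simpl.
- apply (continuous_ext (fun t => - (q t * Re (E t)))); [intros t; unfold Re, Im; simpl; ring|].
  apply (continuous_opp (V := R_NormedModule)), continuous_mult_R; auto.
  exact (ex_derive_continuous_R _ _ _ (proj1 (D x))).
- apply (continuous_ext (fun t => - (q t * Im (E t)))); [intros t; unfold Re, Im; simpl; ring|].
  apply (continuous_opp (V := R_NormedModule)), continuous_mult_R; auto.
  exact (ex_derive_continuous_R _ _ _ (proj2 (D x))).
Qed.

(** In the Laplacian of the product the two coefficients add up, and [- mu] cancels against [mu]. *)
Lemma separated_solution (lambda mu : R) (f1 f2 : R -> R) (E1 E2 : R -> C) :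
  (forall x, continuous f1 x) -> (forall x, continuous f2 x) ->
  bloch_solution (fun x => lambda * f1 x + - mu) E1 ->
  bloch_solution (fun x => lambda * f2 x + mu) E2 ->
  is_solution lambda (fun p => f1 (fst p) + f2 (snd p)) (tensor E1 E2) /\
  bounded_plane (tensor E1 E2) /\
  (exists p : R * R, tensor E1 E2 p <> RtoC 0) /\
  exists alpha beta : R, quasi_periodic alpha E1 /\ quasi_periodic beta E2.
Proof.
intros C1 C2 ((D1 & H1 & H1') & [M1 B1] & N1 & a & Q1)
  ((D2 & H2 & H2') & [M2 B2] & N2 & b & Q2).
split; [|split; [|split]]; eauto.
- split.
  + apply Ck_plane_tensor.
    * apply (bloch_solution_Ck_line (fun x => lambda * f1 x + - mu) E1 D1); auto.
      intros x; apply continuous_affine; auto.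
    * apply (bloch_solution_Ck_line (fun x => lambda * f2 x + mu) E2 D2); auto.
      intros x; apply continuous_affine; auto.
  + intros p; unfold laplacian.
    rewrite (partial1_tensor _ _ _ H1), (partial1_tensor _ _ _ H1').
    rewrite (partial2_tensor _ _ _ H2), (partial2_tensor _ _ _ H2').
    unfold tensor; rewrite !RtoC_plus, RtoC_opp, !RtoC_mult; ring.
- exists (M1 * M2); intros p; unfold tensor; rewrite Cmod_mult.
  apply Rmult_le_compat; auto using Cmod_ge_0.
- exists (0, 0); unfold tensor; simpl; apply Cmult_neq_0; auto.
Qed.

(** * Uniform bounds in [C] and three trial values of the separation constant *)

Theorem theorem2p3 :
  exists lambda0 : R -> R,
  forall eps1 eps2 : R -> R,
    C2_smooth eps1 -> C2_smooth eps2 ->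
    (forall x : R, 0 < eps1 x) -> (forall x : R, 0 < eps2 x) ->
    one_periodic eps1 -> one_periodic eps2 ->
    exists Cmax : R,
      is_maximum (coefficient_values eps1 eps2) Cmax /\
      0 < lambda0 Cmax /\
      forall lambda : R, lambda0 Cmax <= lambda ->
        exists E : R * R -> C,
          is_solution lambda (fun p => eps1 (fst p) + eps2 (snd p)) E /\
          bounded_plane E /\
          (exists p : R * R, E p <> RtoC 0) /\
          exists E1 E2 : R -> C,
            (forall x1 x2 : R, E (x1, x2) = (E1 x1 * E2 x2)%C) /\
            exists alpha beta : R,
              quasi_periodic alpha E1 /\ quasi_periodic beta E2.
Proof.
(* The square of the threshold that [bloch_solution_exists] puts on [L = sqrt lambda]. *)
exists (fun C => (4608 * C ^ 9) ^ 2).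
intros f1 f2 S1 S2 p1 p2 P1 P2.
destruct (coefficient_values_maximum f1 f2) as [C HC]; auto.
exists C; split; auto.
destruct HC as [_ HC].
assert (bound : forall f x, f = f1 \/ f = f2 ->
  Rabs (f x) <= C /\ Rabs (Derive_n f 1 x) <= C /\
  Rabs (Derive_n f 2 x) <= C /\ Rabs (/ f x) <= C).
{ intros f x Hf; repeat split; apply HC; exists f, x; auto. }
assert (low : forall f x, f = f1 \/ f = f2 -> 0 < f x <= C /\ 1 <= C * f x).
{ intros f x Hf.
  assert (f0 : 0 < f x) by (destruct Hf as [-> | ->]; auto).
  pose proof (Rinv_0_lt_compat _ f0).
  destruct (bound f x Hf) as (B0 & _ & _ & B3).
  rewrite Rabs_pos_eq in B0, B3 by lra.
  apply (Rmult_le_compat_r (f x)) in B3; [|lra].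
  rewrite Rinv_l in B3; lra. }
(* The value and its reciprocal are both at most [C], so [1 <= C * f1 0 <= C^2]. *)
assert (C1 : 1 <= C) by (destruct (low f1 0); auto; nra).
assert (C9 : 1 <= C ^ 9) by (apply pow_R1_Rle; auto).
split; [apply pow_lt; lra|].
intros lambda Hl.
set (L := sqrt lambda).
assert (HL : 4608 * C ^ 9 <= L).
{ unfold L; rewrite <- (sqrt_pow2 (4608 * C ^ 9)) by lra.
  apply sqrt_le_1_alt; auto. }
assert (EL : lambda = L ^ 2).
{ symmetry; apply pow2_sqrt; eapply Rle_trans; [apply pow2_ge_0 | exact Hl]. }
assert (h0 : 0 < L / C) by (apply Rdiv_lt_0_compat; lra).
assert (hL : L / C <= L ^ 2 / (2 * C)).
{ replace (L ^ 2 / (2 * C)) with (L / C * (L / 2)) by (field; lra); nra. }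
assert (q4 : (L / (2 * C)) ^ 2 <= L ^ 2 / (2 * C)).
{ replace ((L / (2 * C)) ^ 2) with (L ^ 2 / (2 * C) * / (2 * C)) by (field; lra).
  rewrite <- Rmult_1_r; apply Rmult_le_compat_l; [lra|].
  rewrite <- Rinv_1; apply Rinv_le_contravar; lra. }
(* [lambda * f x] is at least [L ^ 2 / C], and a shift by at most [L / C] removes no more than half
   of that, since [L] is large. *)
assert (range : forall f x m, f = f1 \/ f = f2 -> - (L / C) <= m <= L / C ->
  (L / (2 * C)) ^ 2 <= lambda * f x + m <= (2 * C * L) ^ 2).
{ intros f x m Hf Hm; destruct (low f x Hf) as [[f0 fC] f1C]; rewrite EL.
  assert (L2 : 0 < L ^ 2) by (apply pow_lt; lra).
  assert (G1 : L ^ 2 / C <= L ^ 2 * f x).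
  { apply Rmult_le_compat_l; [lra|].
    apply Rmult_le_reg_l with C; [lra|]; rewrite Rinv_r; lra. }
  replace (L ^ 2 / C) with (2 * (L ^ 2 / (2 * C))) in G1 by (field; lra).
  assert (G2 : L ^ 2 * f x <= L ^ 2 * C) by (apply Rmult_le_compat_l; lra).
  assert (G3 : L ^ 2 / (2 * C) <= L ^ 2 * C).
  { apply Rmult_le_compat_l; [lra|].
    apply Rle_trans with 1; [rewrite <- Rinv_1; apply Rinv_le_contravar; lra | lra]. }
  assert (G4 : L ^ 2 * C <= L ^ 2 * C ^ 2) by (apply Rmult_le_compat_l; nra).
  replace ((2 * C * L) ^ 2) with (4 * (L ^ 2 * C ^ 2)) by ring.
  split; lra. }
(* The candidates are [0], [L / (2 * C)] and [L / C]; any two of them differ by an amount in the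
   range that [phase_gap] admits. *)
set (mu := fun i : nat => INR i * (L / (2 * C))).
assert (hh : L / C = 2 * (L / (2 * C))) by (field; lra).
assert (mu_gap : forall i j, (i < j <= 2)%nat -> L / (2 * C) <= mu j - mu i <= L / C).
{ intros i j Hij; unfold mu; rewrite hh.
  assert (1 <= INR j - INR i <= 2).
  { rewrite <- minus_INR by lia.
    split; [apply (le_INR 1) | apply (le_INR _ 2)]; lia. }
  split; nra. }
assert (mu_range : forall i, (i <= 2)%nat -> 0 <= mu i <= L / C).
{ intros i Hi; unfold mu; rewrite hh.
  assert (0 <= INR i <= 2) by (split; [apply pos_INR | apply (le_INR _ 2); lia]).
  split; nra. }
destruct (C2_smooth_derive f1 S1) as (D1 & D1' & D1'').
destruct (C2_smooth_derive f2 S2) as (D2 & D2' & D2'').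
assert (Cf1 : forall x, continuous f1 x)
  by (intros; eapply ex_derive_continuous_R; eauto).
assert (Cf2 : forall x, continuous f2 x)
  by (intros; eapply ex_derive_continuous_R; eauto).
assert (Cq : forall (f : R -> R) m x, (forall y, continuous f y) ->
  continuous (fun t => lambda * f t + m) x)
  by (intros; apply continuous_affine; auto).
destruct (common_good_index
  (fun i => / (32 * C ^ 2) <=
     Rabs (sin (RInt (fun x => sqrt (lambda * f1 x + - mu i)) 0 1)))
  (fun i => / (32 * C ^ 2) <=
     Rabs (sin (RInt (fun x => sqrt (lambda * f2 x + mu i)) 0 1))))
  as (i & Hi & G1 & G2).
{ intros i j Hij; pose proof (mu_gap i j Hij).
  pose proof (mu_range i ltac:(lia)); pose proof (mu_range j ltac:(lia)).
  (* The first coefficient contains [- mu], so the larger of the two belongs to the smaller index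
     [i] and the alternatives are swapped. *)
  apply or_comm; apply phase_gap with (L := L) (d := mu j - mu i); auto; try lra.
  - intros; apply range; auto; lra.
  - intros; apply range; auto; lra.
  - intros; ring. }
{ intros i j Hij; pose proof (mu_gap i j Hij).
  pose proof (mu_range i ltac:(lia)); pose proof (mu_range j ltac:(lia)).
  apply phase_gap with (L := L) (d := mu j - mu i); auto; try lra.
  - intros; apply range; auto; lra.
  - intros; apply range; auto; lra.
  - intros; ring. }
pose proof (mu_range i Hi).
assert (exB : forall f m, f = f1 \/ f = f2 -> - (L / C) <= m <= L / C ->
  C2_smooth f -> one_periodic f ->
  / (32 * C ^ 2) <= Rabs (sin (RInt (fun x => sqrt (lambda * f x + m)) 0 1)) ->
  exists E, bloch_solution (fun x => lambda * f x + m) E).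
{ intros f m Hf Hm S P G; destruct (C2_smooth_derive f S) as (D & D' & D'').
  apply bloch_solution_exists with (C := C) (L := L)
    (q1 := fun x => lambda * Derive_n f 1 x) (q2 := fun x => lambda * Derive_n f 2 x);
    auto.
  - intros x; rewrite <- (Rplus_0_r (lambda * Derive_n f 1 x)).
    apply (is_derive_plus (V := R_NormedModule) (fun x => lambda * f x) (fun _ => m));
      [apply is_derive_scal; auto | apply (is_derive_const (V := R_NormedModule))].
  - intros x; apply is_derive_scal, D'.
  - intros x; apply continuous_mult_R; auto using continuous_const.
  - intros x; rewrite P; auto.
  - intros x; apply range; auto.
  - intros x; destruct (bound f x Hf) as (_ & B & _).
    rewrite EL, Rabs_mult, (Rabs_pos_eq (L ^ 2)), Rmult_comm by apply pow2_ge_0.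
    apply Rmult_le_compat_r; auto; apply pow2_ge_0.
  - intros x; destruct (bound f x Hf) as (_ & _ & B & _).
    rewrite EL, Rabs_mult, (Rabs_pos_eq (L ^ 2)), Rmult_comm by apply pow2_ge_0.
    apply Rmult_le_compat_r; auto; apply pow2_ge_0. }
destruct (exB f1 (- mu i)) as [E1 HE1]; auto; [lra|].
destruct (exB f2 (mu i)) as [E2 HE2]; auto; [lra|].
destruct (separated_solution lambda (mu i) f1 f2 E1 E2) as (Sol & Bd & Nz & Qp); auto.
exists (tensor E1 E2); split; [|split; [|split]]; auto.
exists E1, E2; split; auto.
Qed.
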